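(* There is a bipartite graph $G$ with no induced cycle $C_k$ for $k>6$ such that $|V(\mathcal{H}(G))|\ge 2^{n/2}-2$, where $n=|V(G)|$.
   Context: A graph is Helly if every family of pairwise intersecting disks $D(v,r)=\{u:d(u,v)\le r\}$ (shortest-path metric) has a common vertex. The injective hull $\mathcal{H}(G)$ of a connected graph $G$ is the unique minimal Helly graph containing $G$ as an isometric subgraph (equivalently, the graph on functions $f:V(G)\to\mathbb{Z}_{\ge0}$ with $f(x)+f(y)\ge d_G(x,y)$ for all $x,y$ and for each $x$ some $y$ with equality, adjacency meaning sup-norm distance 1). *)

(* Defs.v *)
From HB Require Import structures.
From mathcomp Require Import all_boot all_order all_algebra.
From mathcomp Require Import reals exp.

Set Implicit Arguments.
Unset Strict Implicit.
Unset Printing Implicit Defensive.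

(* Finite simple graphs. *)
Record sgraph := SGraph {
  vertex :> finType;
  adj : rel vertex;
  adj_sym : symmetric adj;
  adj_irr : irreflexive adj }.

Definition connected (G : sgraph) : Prop :=
  0 < #|G| /\ forall x y : G, connect (@adj G) x y.

Definition has_walk (G : sgraph) (x y : G) (k : nat) : bool :=
  [exists p : k.-tuple G, path (@adj G) x p && (last x p == y)].

(* A shortest path has fewer than #|G| edges, and the position of k in
   iota 0 #|G| is k itself, so this is the shortest-path distance.  On vertices
   in different components it takes the junk value #|G|; it is only used on
   connected graphs. *)
Definition dist (G : sgraph) (x y : G) : nat :=
  find (has_walk x y) (iota 0 #|G|).

Definition disk (G : sgraph) (v : G) (r : nat) : {set G} :=
  [set u | dist u v <= r].

Definition helly (G : sgraph) : Prop :=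
  connected G /\
  forall (I : Type) (v : I -> G) (r : I -> nat),
    (forall i j, disk (v i) (r i) :&: disk (v j) (r j) != set0) ->
    exists u, forall i, u \in disk (v i) (r i).

Definition isometric (G H : sgraph) (e : G -> H) : Prop :=
  forall x y, dist (e x) (e y) = dist x y.

Definition subgraph_embedding (K H : sgraph) (i : K -> H) : Prop :=
  injective i /\ forall x y, adj x y -> adj (i x) (i y).

(* H, with G placed in it by e, is a minimal Helly graph containing G as an
   isometric subgraph: no proper subgraph K of H (fewer vertices or fewer edges,
   not necessarily induced) that still contains this copy of G is a Helly graph
   in which G is isometric. *)
Definition injective_hull (G H : sgraph) (e : G -> H) : Prop :=
  [/\ helly H,
      isometric e
    & forall (K : sgraph) (e' : G -> K) (i : K -> H),
        subgraph_embedding i -> i \o e' =1 e ->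
        helly K -> isometric e' ->
        bijective i /\ forall x y, adj (i x) (i y) = adj x y].

Definition bipartite (G : sgraph) : Prop :=
  exists c : G -> bool, forall x y, adj x y -> c x != c y.

(* ordS is the cyclic successor on 'I_k; meaningful as a cycle for k >= 3. *)
Definition has_induced_cycle (G : sgraph) (k : nat) : Prop :=
  exists2 c : 'I_k -> G, injective c &
    forall i j, adj (c i) (c j) = (j == ordS i) || (i == ordS j).

(* Main.v *)
Require Import Defs.
From HB Require Import structures.
From mathcomp Require Import all_boot all_order all_algebra.
From mathcomp Require Import zify.
From mathcomp Require Import boolp reals exp.

(** The witness is the crown graph: [K_(m,m)] minus a perfect matching, with
    [n = 2 * m] vertices.  A vertex misses only one vertex of the other side, so
    there is no induced cycle longer than 6.  Matched vertices are at distance 3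
    and all other pairs at distance at most 2, so each of the [2 ^ m] ways of
    giving the values 1 and 2 to the two ends of every matching edge is an
    extremal function; in any Helly graph containing the crown isometrically,
    each extremal function is the distance function to some vertex.
    An injective hull exists because every connected graph embeds isometrically
    in a king's grid, which is Helly; one then takes a smallest Helly extension. *)

Set Implicit Arguments.
Unset Strict Implicit.
Unset Printing Implicit Defensive.

Import Order.TTheory GRing.Theory Num.Theory.

(** * Walks and the shortest-path metric *)

Lemma has_walkP (G : sgraph) (x y : G) k :
  reflect (exists p, [/\ path (@adj G) x p, last x p = y & size p = k])
          (has_walk x y k).
Proof.
apply: (iffP existsP) => [[p /andP[pp /eqP lp]]|[p [pp lp sp]]].
  by exists p; rewrite size_tuple.
by move/eqP in sp; exists (Tuple sp); rewrite /= pp lp eqxx.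
Qed.

Section Distance.
Variable G : sgraph.
Hypothesis Gc : connected G.
Implicit Types x y z : G.

(** Replaces the search defining [dist] by the existence of a short walk. In a connected graph a
    walk shortens to one with distinct vertices, hence fewer than [#|G|] edges, so the search
    succeeds. *)
Lemma dist_leP x y k :
  reflect (exists p, [/\ path (@adj G) x p, last x p = y & size p <= k])
          (dist x y <= k).
Proof.
have [_ conn] := Gc.
have hw : has (has_walk x y) (iota 0 #|G|).
  have /connectP[p pp ->] := conn x y.
  case: (shortenP pp) => q qp uq _.
  apply/hasP; exists (size q).
    rewrite mem_iota add0n /=.
    by have := max_card (mem (x :: q)); rewrite (card_uniqP uq).
  by apply/has_walkP; exists q.
have lt : dist x y < #|G| by rewrite -[X in _ < X](size_iota 0) -has_find.
apply: (iffP idP) => [le|[p [pp lp le]]].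
  have := nth_find 0 hw; rewrite nth_iota // add0n.
  by case/has_walkP => p [pp lp sp]; exists p; rewrite sp.
apply: leq_trans le; rewrite leqNgt; apply/negP => ltp.
have := before_find 0 ltp; rewrite nth_iota ?add0n; last exact: ltn_trans lt.
by move/negbT/negP; apply; apply/has_walkP; exists p.
Qed.

Lemma distxx x : dist x x = 0.
Proof. by apply/eqP; rewrite -leqn0; apply/dist_leP; exists [::]. Qed.

Lemma dist_sym x y : dist x y = dist y x.
Proof.
suff le (a b : G) : dist a b <= dist b a by apply/eqP; rewrite eqn_leq !le.
have /dist_leP[p [pp lp sp]] := leqnn (dist b a).
apply/dist_leP; exists (rev (belast b p)); split.
- rewrite -lp -(eq_path (e := fun z => (@adj G)^~ z)) ?rev_path //.
  by move=> u v; rewrite adj_sym.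
- case: p lp {pp sp} => [/= <- //|c p lp].
  by rewrite /= rev_cons last_rcons.
- by rewrite size_rev size_belast.
Qed.

Lemma dist_triangle y x z : dist x z <= dist x y + dist y z.
Proof.
have /dist_leP[p [pp lp sp]] := leqnn (dist x y).
have /dist_leP[q [qp lq sq]] := leqnn (dist y z).
apply/dist_leP; exists (p ++ q).
by rewrite cat_path pp last_cat lp qp lq size_cat leq_add.
Qed.

(** Cut a shortest walk from [x] to [y] after [a] steps: the cut vertex lies in both disks. *)
Lemma disk_meet x y a b :
  dist x y <= a + b -> disk x a :&: disk y b != set0.
Proof.
case/dist_leP => p [pp lp sp]; apply/set0Pn; exists (last x (take a p)).
have := pp; rewrite -{1}(cat_take_drop a p) cat_path => /andP[p1 p2].
rewrite !inE; apply/andP; split.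
  rewrite dist_sym; apply/dist_leP; exists (take a p).
  by rewrite size_take_min geq_minl.
apply/dist_leP; exists (drop a p); split => //.
  by rewrite -last_cat cat_take_drop.
by rewrite size_drop; lia.
Qed.

Lemma disk_meet_dist x y a b :
  disk x a :&: disk y b != set0 -> dist x y <= a + b.
Proof.
case/set0Pn => u; rewrite !inE => /andP[xa yb].
by apply: leq_trans (dist_triangle u x y) _; rewrite (dist_sym x) leq_add.
Qed.

End Distance.

(** The disks of radius [f x] around [e x] meet pairwise, so they share a vertex [u]. Tightness at
    [x] and the triangle inequality through [u] turn the bound [f x] into an equality. *)
Lemma extremal_realized (G H : sgraph) (e : G -> H) (f : G -> nat) :
    helly H -> isometric e ->
    (forall x y, dist x y <= f x + f y) ->
    (forall x, exists y, dist x y = f x + f y) ->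
  exists u, forall x, dist u (e x) = f x.
Proof.
move=> [Hc hH] ie fge ftight.
have [i j|u uP] := hH G e f; first by apply: disk_meet; rewrite ?ie.
exists u => x; have [y dxy] := ftight x.
have := uP x; have := uP y; have := dist_triangle Hc u (e x) (e y).
by rewrite !inE ie dxy (dist_sym Hc (e x)); lia.
Qed.

(** * The king's grid: its metric is the sup norm, and it is Helly *)

Section KingGrid.
Variables (T : finType) (n : nat).
Implicit Types f g : {ffun T -> 'I_n.+1}.

Definition king_close k f g := [forall x, (f x <= g x + k) && (g x <= f x + k)].

Lemma king_closeP k f g :
  reflect (forall x, f x <= g x + k /\ g x <= f x + k) (king_close k f g).
Proof. by apply: (iffP forallP) => h x; apply/andP. Qed.

Lemma king_close_mono k l f g : k <= l -> king_close k f g -> king_close l f g.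
Proof.
by move=> kl /king_closeP fg; apply/king_closeP => x; have := fg x; lia.
Qed.

Definition king_adj f g := (f != g) && king_close 1 f g.

Lemma king_adj_sym : symmetric king_adj.
Proof.
move=> f g; rewrite /king_adj eq_sym; congr (_ && _).
by apply: eq_forallb => x; rewrite andbC.
Qed.

Lemma king_adj_irr : irreflexive king_adj.
Proof. by move=> f; rewrite /king_adj eqxx. Qed.

Definition king_grid := SGraph king_adj_sym king_adj_irr.

Lemma king_walk f p : path king_adj f p -> king_close (size p) f (last f p).
Proof.
elim: p f => [|g p IH] f /=; first by move=> _; apply/king_closeP => x; lia.
case/andP=> /andP[_ /king_closeP fg] /IH /king_closeP gl.
by apply/king_closeP => x; have := fg x; have := gl x; lia.
Qed.

Definition king_step f g : {ffun T -> 'I_n.+1} :=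
  [ffun x => if f x < g x then inord (f x).+1
             else if g x < f x then inord (f x).-1 else f x].

Lemma king_stepE f g x :
  king_step f g x = (if f x < g x then (f x).+1
             else if g x < f x then (f x).-1 else f x) :> nat.
Proof.
rewrite ffunE; have fn := ltn_ord (f x); have gn := ltn_ord (g x).
by do 2?[case: ifP => ?] => //; rewrite inordK //; lia.
Qed.

(** All coordinates move one unit towards [g] at once, so one [king_step] lowers the sup-norm bound
    by one. *)
Lemma king_walk_exists k f g : king_close k f g ->
  exists p, [/\ path king_adj f p, last f p = g & size p <= k].
Proof.
elim: k f => [|k IH] f /king_closeP fg.
  exists [::]; split=> //=; apply/ffunP => x; apply/val_inj => /=.
  by have := fg x; lia.
have [<-|nfg] := eqVneq f g; first by exists [::].
have [|p [pp lp sp]] := IH (king_step f g).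
  apply/king_closeP => x; rewrite king_stepE; have := fg x.
  by do 2?[case: ifP => ?]; lia.
exists (king_step f g :: p); split => //=; rewrite pp andbT; apply/andP; split.
  apply: contra_neq nfg => E; apply/ffunP => x; apply/val_inj => /=.
  move/ffunP/(_ x)/(congr1 val): E; rewrite /= king_stepE.
  by do 2?[case: ifP => ?]; lia.
apply/king_closeP => x; rewrite king_stepE.
by do 2?[case: ifP => ?]; lia.
Qed.

Lemma king_grid_connected : connected king_grid.
Proof.
split=> [|f g]; first by apply/card_gt0P; exists [ffun => ord0].
have [|p [pp lp _]] := @king_walk_exists n f g.
  by apply/king_closeP => x; split; apply: leq_trans (leq_ord _) (leq_addl _ _).
by apply/connectP; exists p.
Qed.

Lemma king_dist_le f g k : (dist (f : king_grid) g <= k) = king_close k f g.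
Proof.
apply/(dist_leP king_grid_connected)/idP; last exact: king_walk_exists.
by case=> p [/king_walk fg <- /king_close_mono]; apply.
Qed.

(* Disks are boxes, so the Helly property reduces to that of intervals: the
   least common upper bound [t] of the left ends works in each coordinate. *)
Lemma king_grid_helly : helly king_grid.
Proof.
split=> [|I v r vr]; first exact: king_grid_connected.
change (I -> {ffun T -> 'I_n.+1}) in v.
suff [u uP] : exists u : T -> 'I_n.+1,
    forall x i, v i x <= u x + r i /\ u x <= v i x + r i.
  exists (finfun u) => i; rewrite inE king_dist_le; apply/king_closeP => x.
  by rewrite ffunE; have [] := uP x i.
apply: (@fin_all_exists _ _ (fun x (t : 'I_n.+1) =>
  forall i, v i x <= t + r i /\ t <= v i x + r i)) => x.
have ex : exists t, `[< forall i, v i x <= t + r i >].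
  by exists n; apply/asboolP => i; have := ltn_ord (v i x); lia.
case: (ex_minnP ex) => t /asboolP tP tmin.
have tn : t < n.+1.
  rewrite ltnS; apply: tmin; apply/asboolP => i.
  by have := ltn_ord (v i x); lia.
exists (Ordinal tn) => i /=; split; first exact: tP.
case: t {tn} tP tmin => // t tP tmin.
(* If [t.+1] passed the right end of interval [i], then [t] would already bound every left end,
   since each interval [j] meets interval [i]; this contradicts minimality. *)
rewrite leqNgt; apply/negP => lt.
suff : t < t by rewrite ltnn.
apply: tmin; apply/asboolP => j.
have := disk_meet_dist king_grid_connected (vr i j).
by rewrite king_dist_le => /king_closeP/(_ x); lia.
Qed.

End KingGrid.

(** Kuratowski embedding: [x] goes to its distance function. The triangle inequality bounds the
    sup-norm distance of two images by [dist x y], and coordinate [y] attains it. *)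
Lemma isometric_helly_extension (G : sgraph) : connected G ->
  exists (H : sgraph) (e : G -> H), helly H /\ isometric e.
Proof.
move=> Gc; exists (king_grid G #|G|).
exists (fun x => [ffun z => inord (dist x z)]).
split=> [|x y]; first exact: king_grid_helly.
have eE (z w : G) : (inord (dist z w) : 'I_#|G|.+1) = dist z w :> nat.
  by rewrite inordK // ltnS -[X in _ <= X](size_iota 0) find_size.
have le_dist k : (dist ([ffun z => inord (dist x z)] : king_grid G #|G|)
       [ffun z => inord (dist y z)] <= k) = (dist x y <= k).
  rewrite king_dist_le; apply/king_closeP/idP => [/(_ y)|le z].
    by rewrite !ffunE !eE distxx //; lia.
  rewrite !ffunE !eE.
  have := dist_triangle Gc y x z; have := dist_triangle Gc x y z.
  by rewrite (dist_sym Gc y x); lia.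
by apply/eqP; rewrite eqn_leq le_dist leqnn -le_dist leqnn.
Qed.

(** * Minimal Helly extensions, by counting vertices and edges *)

Section Subgraph.
Variables (K H : sgraph) (i : K -> H).
Hypothesis emb : subgraph_embedding i.

Definition edges (G : sgraph) : {set G * G} := [set p | adj p.1 p.2].

Let i2 (p : K * K) := (i p.1, i p.2).

Let i2_inj : injective i2.
Proof. by case: emb => ii _ [a b] [c d] [/ii -> /ii ->]. Qed.

Let sub_edges : i2 @: edges K \subset edges H.
Proof.
case: emb => _ ia; apply/subsetP => _ /imsetP[p pK ->].
by move: pK; rewrite !inE; apply: ia.
Qed.

(** Vertices and edges of [K] both inject into those of [H], so comparing the totals forces equality
    in both counts. *)
Lemma subgraph_embedding_iso :
    #|H| + #|edges H| <= #|K| + #|edges K| ->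
  bijective i /\ forall x y, adj (i x) (i y) = adj x y.
Proof.
move=> le; case: emb => ii ia.
have leV := leq_card i ii.
have leE := subset_leq_card sub_edges; rewrite card_imset // in leE.
split.
  apply: inj_card_bij ii _.
  by rewrite -(leq_add2r #|edges K|) (leq_trans _ le) // leq_add2l.
move=> x y; apply/idP/idP => [a|]; last exact: ia.
have E : i2 @: edges K = edges H.
  apply/eqP; rewrite eqEcard sub_edges card_imset //=.
  by rewrite -(leq_add2l #|K|) (leq_trans _ le) // leq_add2r.
have : i2 (x, y) \in edges H by rewrite inE.
by rewrite -E mem_imset // inE.
Qed.

End Subgraph.

Lemma injective_hull_exists (G : sgraph) : connected G ->
  exists (H : sgraph) (e : G -> H), injective_hull e.
Proof.
move=> Gc.
have ex : exists s, `[< exists (H : sgraph) (e : G -> H),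
    [/\ helly H, isometric e & #|H| + #|edges H| = s] >].
  have [H [e [hH ie]]] := isometric_helly_extension Gc.
  by exists (#|H| + #|edges H|); apply/asboolP; exists H, e.
case: (ex_minnP ex) => s /asboolP[H [e [hH ie sE]]] smin.
exists H, e; split=> // K e' i emb _ hK ie'.
apply: subgraph_embedding_iso => //.
by rewrite sE; apply: smin; apply/asboolP; exists K, e'.
Qed.

(** * The crown graph and its distances *)

Section Crown.
Variable m : nat.

Definition crown_adj : rel (bool * 'I_m) :=
  fun x y => (x.1 != y.1) && (x.2 != y.2).

Lemma crown_adj_sym : symmetric crown_adj.
Proof. by move=> x y; rewrite /crown_adj (eq_sym x.1) (eq_sym x.2). Qed.

Lemma crown_adj_irr : irreflexive crown_adj.
Proof. by move=> x; rewrite /crown_adj eqxx. Qed.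

Definition crown := SGraph crown_adj_sym crown_adj_irr.

Lemma card_crown : #|crown| = m.*2.
Proof. by rewrite card_prod card_bool card_ord mul2n. Qed.

Lemma crown_bipartite : bipartite crown.
Proof. by exists fst => x y /andP[]. Qed.

(* [c 3] and [c 5] lie on the side opposite to [c 0] and are not adjacent to it,
   so both are the vertex matched with [c 0]. *)
Lemma crown_no_long_induced_cycle k : 6 < k -> ~ has_induced_cycle crown k.
Proof.
case: k => [//|k] k6 [c cinj cadj].
have side j : j < 5 -> (c (inord j.+1)).1 = ~~ (c (inord j)).1.
  move=> j5; have : adj (c (inord j)) (c (inord j.+1)).
    rewrite cadj; apply/orP; left; apply/eqP/val_inj => /=.
    by rewrite !inordK ?modn_small //; lia.
  by case/andP; case: (c _).1; case: (c _).1.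
have matched j : (j == 3) || (j == 5) -> (c (inord j)).2 = (c (inord 0)).2.
  move=> j35; apply/eqP.
  have sj : (c (inord 0)).1 != (c (inord j)).1.
    by case/orP: j35 => /eqP ->; rewrite !side //; case: (c _).1.
  (* A length above 6 is used here: it keeps 5 from being the cyclic predecessor of 0. *)
  have : ~~ adj (c (inord 0)) (c (inord j)).
    rewrite cadj negb_or; apply/andP; split; apply/eqP => /(congr1 val) /=;
      rewrite !inordK ?modn_small //; lia.
  by rewrite /= /crown_adj sj /= negbK eq_sym.
have /cinj /(congr1 val) : c (inord 3) = c (inord 5).
  rewrite [LHS]surjective_pairing [RHS]surjective_pairing !matched //.
  by rewrite !side // !negbK.
by rewrite /= !inordK //; lia.
Qed.

Hypothesis m3 : 2 < m.

Lemma ord_avoid2 (i j : 'I_m) : exists k : 'I_m, (k != i) && (k != j).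
Proof.
have : 0 < #|~: [set i; j]|.
  have := cardsC [set i; j]; rewrite card_ord cards2; case: (i != j); lia.
by case/card_gt0P => k; rewrite !inE negb_or; exists k.
Qed.

Lemma crown_walk (x y : crown) :
  exists p, [/\ path crown_adj x p, last x p = y
    & size p <= if x.2 == y.2 then (if x.1 == y.1 then 0 else 3) else 2].
Proof.
case: x y => [s i] [t j] /=; case: (eqVneq i j) => [<-|ij].
  have [<-|st] := eqVneq s t; first by exists [::].
  have [k /andP[ki _]] := ord_avoid2 i i.
  have [l /andP[li lk]] := ord_avoid2 i k.
  exists [:: (t, k); (s, l); (t, i)].
  by rewrite /= /crown_adj /= st (eq_sym t) st (eq_sym i) ki (eq_sym k) lk li.
have [<-|st] := eqVneq s t.
  have [k /andP[ki kj]] := ord_avoid2 i j.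
  exists [:: (~~ s, k); (s, j)].
  by rewrite /= /crown_adj /= (eq_sym i) ki kj; case: s.
by exists [:: (t, j)]; rewrite /= /crown_adj /= st ij.
Qed.

Lemma crown_connected : connected crown.
Proof.
split=> [|x y]; first by rewrite card_crown; lia.
by have [p [pp lp _]] := crown_walk x y; apply/connectP; exists p.
Qed.

Lemma crown_dist_matched s i : dist ((s, i) : crown) (~~ s, i) = 3.
Proof.
apply/eqP; rewrite eqn_leq; apply/andP; split.
  apply/(dist_leP crown_connected).
  by have := crown_walk (s, i) (~~ s, i); rewrite /= eqxx; case: s.
(* Length 0 keeps the side, length 1 changes the index, and length 2 returns to the starting
   side. *)
rewrite ltnNge; apply/negP => /(dist_leP crown_connected)[p [pp lp]].
case: p pp lp => [|[t j] [|[u k] [|]]] //=; rewrite /crown_adj /=.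
- by move=> _ []; case: s.
- by case/andP=> /andP[_ ij] _ [_ E]; rewrite E eqxx in ij.
- case/and3P=> /andP[st _] /andP[tu _] _ [E _]; subst u.
  by case: s t st tu => [] [].
Qed.

(** [S] records the matching edges whose [false] end gets the value 2; the two ends of a matching
    edge always sum to 3, their distance. *)
Definition crown_extremal (S : {set 'I_m}) (x : crown) : nat :=
  (x.1 (+) (x.2 \in S)).+1.

Lemma crown_extremal_ge S x y :
  dist x y <= crown_extremal S x + crown_extremal S y.
Proof.
have /(dist_leP crown_connected) le := crown_walk x y.
apply: leq_trans le _; rewrite /crown_extremal.
case: x y => [s i] [t j] /=; have [<-|ij] := eqVneq i j; last by lia.
by case: s t (i \in S) => [] [] [].
Qed.

Lemma crown_extremal_tight S x :
  exists y, dist x y = crown_extremal S x + crown_extremal S y.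
Proof.
case: x => s i; exists (~~ s, i); rewrite crown_dist_matched /crown_extremal /=.
by case: s (i \in S) => [] [].
Qed.

(** A vertex realizing the function of [S] determines [S]: its distance to the image of [(false, i)]
    tells whether [i] is in [S]. *)
Lemma crown_helly_extension_card (H : sgraph) (e : crown -> H) :
  helly H -> isometric e -> 2 ^ m <= #|H|.
Proof.
move=> hH ie.
have /fin_all_exists[u uP] S := extremal_realized hH ie
  (crown_extremal_ge S) (crown_extremal_tight S).
have uinj : injective u.
  move=> S S' E; apply/setP => i.
  have := uP S (false, i); rewrite E uP /crown_extremal /=.
  by case: (i \in S) (i \in S') => [] [].
have := leq_card u uinj.
by rewrite -cardsT -powersetT card_powerset cardsT card_ord.
Qed.

End Crown.

Local Open Scope ring_scope.

Theorem theorem8 (R : realType) (N : nat) :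
  exists G : sgraph,
    [/\ (N <= #|G|)%N,
        connected G,
        bipartite G,
        (forall k : nat, (6 < k)%N -> ~ has_induced_cycle G k)
      & (exists (H : sgraph) (e : G -> H), injective_hull e) /\
        (forall (H : sgraph) (e : G -> H), injective_hull e ->
           2 `^ (#|G|%:R / 2) - 2 <= #|H|%:R :> R)].
Proof.
have m3 : (2 < N.+3)%N by [].
exists (crown N.+3); split.
- by rewrite card_crown; lia.
- exact: crown_connected.
- exact: crown_bipartite.
- exact: crown_no_long_induced_cycle.
split; first exact/injective_hull_exists/crown_connected.
move=> H e [hH ie _].
(* Half the number of vertices is the integer [N.+3], so the real power becomes a natural one. *)
rewrite card_crown -muln2 natrM mulfK ?pnatr_eq0 // powR_mulrn ?ler0n //.
apply: (@le_trans _ _ (2 ^+ N.+3)); first by rewrite gerBl ler0n.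
by rewrite -natrX ler_nat; exact: crown_helly_extension_card hH ie.
Qed.
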